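(* For a power bounded $T\in\mathcal{B}(\mathbb{C}^d)$ the following are equivalent: (i) the sequence $\{T^{*n}T^n\}_{n\ge1}$ converges; (ii) eigenspaces of $T$ corresponding to distinct eigenvalues of modulus $1$ are mutually orthogonal. Moreover, the following three sets coincide: $\{A:\ A=\lim_{n\to\infty}T^{*n}T^n$ for some power bounded $T\in\mathcal{B}(\mathbb{C}^d)$ for which the limit exists$\}$; $\{P^*P:\ P\in\mathcal{B}(\mathbb{C}^d),\ P^2=P\}$; $\{A\in\mathcal{B}(\mathbb{C}^d)$ positive semidefinite$:\ \sigma(A)\subseteq\{0\}\cup[1,\infty)$ and $\dim\ker A\ge\operatorname{rank}E(]1,\infty[)\}$, where $E$ is the spectral measure of $A$.
   Context: $T$ is power bounded if $\sup_n\|T^n\|<\infty$. $\sigma(A)$ denotes the spectrum. *)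

(* Defs.v *)
From Stdlib Require Import Reals.
Open Scope R_scope.

Record C := mkC { Cre : R; Cim : R }.

Definition C0 : C := mkC 0 0.
Definition C1 : C := mkC 1 0.
Definition RtoC (r : R) : C := mkC r 0.
Definition Cadd (z w : C) : C := mkC (Cre z + Cre w) (Cim z + Cim w).
Definition Copp (z : C) : C := mkC (- Cre z) (- Cim z).
Definition Csub (z w : C) : C := Cadd z (Copp w).
Definition Cmul (z w : C) : C :=
  mkC (Cre z * Cre w - Cim z * Cim w) (Cre z * Cim w + Cim z * Cre w).
Definition Cconj (z : C) : C := mkC (Cre z) (- Cim z).
Definition Cmod (z : C) : R := sqrt (Cre z * Cre z + Cim z * Cim z).

Fixpoint Csum (n : nat) (f : nat -> C) : C :=
  match n with
  | O => C0
  | S m => Cadd (Csum m f) (f m)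
  end.

Definition vec := nat -> C.
Definition Mat := nat -> nat -> C.

Definition veq (d : nat) (x y : vec) : Prop := forall i, (i < d)%nat -> x i = y i.
Definition meq (d : nat) (A B : Mat) : Prop :=
  forall i j, (i < d)%nat -> (j < d)%nat -> A i j = B i j.

Definition vzero : vec := fun _ => C0.
Definition vscale (c : C) (x : vec) : vec := fun i => Cmul c (x i).
Definition vsub (x y : vec) : vec := fun i => Csub (x i) (y i).
Definition vsum (n : nat) (f : nat -> vec) : vec := fun i => Csum n (fun k => f k i).

Definition inner (d : nat) (x y : vec) : C := Csum d (fun i => Cmul (x i) (Cconj (y i))).
Definition vnorm (d : nat) (x : vec) : R := sqrt (Cre (inner d x x)).

Definition Id : Mat := fun i j => if Nat.eqb i j then C1 else C0.
Definition mmul (d : nat) (A B : Mat) : Mat :=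
  fun i j => Csum d (fun k => Cmul (A i k) (B k j)).
Definition msub (A B : Mat) : Mat := fun i j => Csub (A i j) (B i j).
Definition mscal (c : C) (A : Mat) : Mat := fun i j => Cmul c (A i j).
Definition adj (A : Mat) : Mat := fun i j => Cconj (A j i).
Definition mv (d : nat) (A : Mat) (x : vec) : vec :=
  fun i => Csum d (fun k => Cmul (A i k) (x k)).
Fixpoint mpow (d : nat) (A : Mat) (n : nat) : Mat :=
  match n with
  | O => Id
  | S m => mmul d (mpow d A m) A
  end.

Definition power_bounded (d : nat) (T : Mat) : Prop :=
  exists M : R, forall (n : nat) (x : vec),
    vnorm d (mv d (mpow d T n) x) <= M * vnorm d x.

Definition mat_limit (d : nat) (S : nat -> Mat) (L : Mat) : Prop :=
  forall eps : R, eps > 0 -> exists N : nat, forall n : nat, (n >= N)%nat ->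
    forall x : vec, vnorm d (mv d (msub (S n) L) x) <= eps * vnorm d x.

Definition mat_converges (d : nat) (S : nat -> Mat) : Prop :=
  exists L : Mat, mat_limit d S L.

(* the sequence T^{*n} T^n (indexed from n >= 1; the starting index is irrelevant) *)
Definition TstarnTn (d : nat) (T : Mat) : nat -> Mat :=
  fun n => mmul d (adj (mpow d T n)) (mpow d T n).

Definition in_eigenspace (d : nat) (T : Mat) (lam : C) (x : vec) : Prop :=
  veq d (mv d T x) (vscale lam x).

Definition unimodular_eigenspaces_orthogonal (d : nat) (T : Mat) : Prop :=
  forall (lam mu : C) (x y : vec),
    Cmod lam = 1 -> Cmod mu = 1 -> lam <> mu ->
    in_eigenspace d T lam x -> in_eigenspace d T mu y ->
    inner d x y = C0.

Definition idempotent (d : nat) (P : Mat) : Prop := meq d (mmul d P P) P.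

Definition pos_semidef (d : nat) (A : Mat) : Prop :=
  forall x : vec, Cim (inner d (mv d A x) x) = 0 /\ 0 <= Cre (inner d (mv d A x) x).

Definition spectrum (d : nat) (A : Mat) (lam : C) : Prop :=
  ~ exists B : Mat,
      meq d (mmul d (msub A (mscal lam Id)) B) Id /\
      meq d (mmul d B (msub A (mscal lam Id))) Id.

Definition lin_indep (d k : nat) (v : nat -> vec) : Prop :=
  forall c : nat -> C,
    veq d (vsum k (fun i => vscale (c i) (v i))) vzero ->
    forall i, (i < k)%nat -> c i = C0.

Definition is_dim (d : nat) (V : vec -> Prop) (n : nat) : Prop :=
  (exists v : nat -> vec, (forall i, (i < n)%nat -> V (v i)) /\ lin_indep d n v) /\
  ~ (exists v : nat -> vec, (forall i, (i < S n)%nat -> V (v i)) /\ lin_indep d (S n) v).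

Definition kernel (d : nat) (A : Mat) : vec -> Prop := fun x => veq d (mv d A x) vzero.

(* range of the spectral projection E(]1,oo[) of the selfadjoint A, i.e. the
   span of the eigenvectors of A with eigenvalues in ]1,oo[ *)
Definition spec_range_gt1 (d : nat) (A : Mat) : vec -> Prop := fun x =>
  exists (n : nat) (v : nat -> vec) (l : nat -> R),
    (forall i, (i < n)%nat -> 1 < l i /\ in_eigenspace d A (RtoC (l i)) (v i)) /\
    veq d x (vsum n v).

Definition limit_set (d : nat) (A : Mat) : Prop :=
  exists T : Mat, power_bounded d T /\ mat_limit d (TstarnTn d T) A.

Definition idem_set (d : nat) (A : Mat) : Prop :=
  exists P : Mat, idempotent d P /\ meq d (mmul d (adj P) P) A.

Definition spectral_set (d : nat) (A : Mat) : Prop :=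
  pos_semidef d A /\
  (forall lam : C, spectrum d A lam ->
     lam = C0 \/ (Cim lam = 0 /\ 1 <= Cre lam)) /\
  exists m r : nat, is_dim d (kernel d A) m /\ is_dim d (spec_range_gt1 d A) r /\ (r <= m)%nat.

(* Main.v *)
Require Import Defs.
From HB Require Import structures.
From mathcomp Require Import all_boot all_order all_algebra.
From mathcomp Require Import ring complex Rstruct.

(** The limit of [T^*n T^n] is [P^* P], where [P] is the projection onto the span of the
    unimodular eigenvectors of [T] along the stable space [{x | T^n x -> 0}].  Power boundedness
    excludes roots of the characteristic polynomial outside the unit disc and makes those on the
    circle semisimple, so these two spaces span everything.  If the unimodular eigenspaces are
    mutually orthogonal, [T] is isometric on their sum, so that [<T^n x, T^n y> -> <Px, Py>].
    Conversely, for unimodular eigenvectors [<T^n x, T^n y> = (a b^-1)^n <x, y>] converges only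
    if [a = b] or [<x, y> = 0].

    For [A = P^* P] with [P] idempotent, a nonzero eigenvalue [a] with eigenvector [v] has
    [P^* v = v], hence [0 <= |v - Pv|^2 = (a - 1) |v|^2]; and [1 - P], whose range is contained in
    [ker A], is injective on the span of the eigenvectors with [a > 1].  Conversely, an idempotent
    [P] with [P^* P = A] adds to each eigenvector with [a > 1] a multiple of its own kernel
    vector. *)

Set Implicit Arguments.
Unset Strict Implicit.
Unset Printing Implicit Defensive.
Import Order.TTheory GRing.Theory Num.Theory.
Local Open Scope ring_scope.
Local Open Scope sesquilinear_scope.

(** * Sequences tending to zero *)

Section NullSequences.
Variable C : archiClosedFieldType.
Implicit Types (u v : nat -> C) (a b z e K : C).

(** In the order of [C] a positive [e] is real, so [e] ranges over the usual positive radii. *)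
Definition tends0 u :=
  forall e, 0 < e -> exists N, forall n, (N <= n)%N -> `|u n| <= e.

Lemma tends0_le u v : (forall n, `|u n| <= `|v n|) -> tends0 v -> tends0 u.
Proof.
move=> uv v0 e /v0[N hN]; exists N => n /hN; exact: le_trans.
Qed.

Lemma eq_tends0 u v : u =1 v -> tends0 v -> tends0 u.
Proof. by move=> uv; apply: tends0_le => n; rewrite uv. Qed.

Lemma tends0_eventually u v N :
  (forall n, (N <= n)%N -> u n = v n) -> tends0 v -> tends0 u.
Proof.
move=> uv v0 e /v0[M hM]; exists (maxn N M) => n.
by rewrite geq_max => /andP[/uv-> /hM].
Qed.

Lemma tends0_0 : tends0 (fun=> 0).
Proof. by move=> e e0; exists 0 => n _; rewrite normr0 ltW. Qed.

Lemma tends0D u v : tends0 u -> tends0 v -> tends0 (fun n => u n + v n).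
Proof.
move=> u0 v0 e e0; have e2 : 0 < e / 2 by rewrite divr_gt0.
have [N hN] := u0 _ e2; have [M hM] := v0 _ e2.
exists (maxn N M) => n; rewrite geq_max => /andP[/hN un /hM vn].
by rewrite (splitr e); apply: le_trans (ler_normD _ _) (lerD un vn).
Qed.

Lemma tends0_sum (I : finType) (F : I -> nat -> C) :
  (forall i, tends0 (F i)) -> tends0 (fun n => \sum_i F i n).
Proof.
move=> F0; elim: (index_enum I) => [|i s IHs].
  by apply: (eq_tends0 _ tends0_0) => n; rewrite big_nil.
by apply: eq_tends0 (tends0D (F0 i) IHs) => n; rewrite big_cons.
Qed.

Lemma tends0_bounded u v K : (forall n, `|v n| <= K) -> tends0 u ->
  tends0 (fun n => u n * v n).
Proof.
move=> vK u0 e e0.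
have K0 : 0 <= K by apply: le_trans (vK 0%N).
have K1 : 0 < K + 1 by rewrite ltr_wpDl.
have [|N hN] := u0 (e / (K + 1)); first by rewrite divr_gt0.
exists N => n /hN un; rewrite normrM -[e](divfK (lt0r_neq0 K1)).
by apply: ler_pM => //; apply: le_trans (vK n) _; rewrite lerDl.
Qed.

Lemma tends0Z u a : tends0 u -> tends0 (fun n => a * u n).
Proof.
move=> /(@tends0_bounded _ (fun=> a) `|a|) h.
by apply: eq_tends0 (h _) => // n; rewrite mulrC.
Qed.

Lemma tends0N u : tends0 u -> tends0 (fun n => - u n).
Proof. by apply: tends0_le => n; rewrite normrN. Qed.

Lemma tends0_conj u : tends0 u -> tends0 (fun n => (u n)^*).
Proof. by apply: tends0_le => n; rewrite norm_conjC. Qed.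

Lemma tends0_shift u : tends0 u -> tends0 (fun n => u n.+1).
Proof. by move=> u0 e /u0[N hN]; exists N => n /leqW/hN. Qed.

Lemma tends0_const a : tends0 (fun=> a) -> a = 0.
Proof.
move=> a0; apply/eqP; apply: contraT => an0.
have a2 : 0 < `|a| / 2 by rewrite divr_gt0 ?normr_gt0.
have [N /(_ N (leqnn N))] := a0 _ a2.
rewrite ler_pdivlMr // ger_pMr ?normr_gt0 //.
by rewrite -[1]/(1%:R) ler_nat.
Qed.

Lemma archi_mul_bounded a K : (forall n, n%:R * `|a| <= K) -> a = 0.
Proof.
move=> h; apply/eqP; apply: contraT => an0; rewrite -normr_gt0 in an0.
have K0 : 0 <= K by have := h 0%N; rewrite mul0r.
have q0 : 0 <= K / `|a| by rewrite divr_ge0.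
have := archi_boundP q0; rewrite ltr_pdivrMr // => /lt_le_trans/(_ (h _)).
by rewrite ltxx.
Qed.

Lemma bernoulli_ineq b n : 0 <= b -> 1 + n%:R * b <= (1 + b) ^+ n.
Proof.
move=> b0; elim: n => [|n IHn]; first by rewrite mul0r addr0.
rewrite exprS; apply: (@le_trans _ _ ((1 + b) * (1 + n%:R * b))).
  rewrite -subr_ge0 -natr1.
  have -> : (1 + b) * (1 + n%:R * b) - (1 + (n%:R + 1) * b) = n%:R * (b * b).
    by ring.
  by rewrite mulr_ge0 ?ler0n // mulr_ge0.
by rewrite ler_wpM2l // addr_ge0.
Qed.

(** Bernoulli's inequality gives [|z| ^ n >= n * b] for [b = |z| - 1], so the multiples of [|b * a|]
    stay bounded, against the Archimedean property. This rules out eigenvalues outside the closed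
    disc. *)
Lemma expr_bounded_eq0 z a K :
  1 < `|z| -> (forall n, `|z ^+ n * a| <= K) -> a = 0.
Proof.
move=> z1 h; set b := `|z| - 1.
have b0 : 0 < b by rewrite subr_gt0.
suff : b * a = 0 by move/eqP; rewrite mulf_eq0 gt_eqF //= => /eqP.
apply: (@archi_mul_bounded _ K) => n; apply: le_trans (h n).
rewrite !normrM (gtr0_norm b0) mulrA ler_wpM2r // normrX.
have -> : `|z| = 1 + b by rewrite /b addrC subrK.
by apply: le_trans (bernoulli_ineq n (ltW b0)); rewrite lerDr.
Qed.

Lemma tends0_expr z : `|z| < 1 -> tends0 (fun n => z ^+ n).
Proof.
move=> z1; have [->|zn0] := eqVneq z 0.
  by apply: (@tends0_eventually _ (fun=> 0) 1 _ tends0_0) => -[//|n] _; rewrite expr0n.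
have z0 : 0 < `|z| by rewrite normr_gt0.
(* Bernoulli is applied to [1 / |z| = 1 + b], which makes [|z| ^ -n] exceed [1 / e] once [n * b]
   does. *)
set b := `|z|^-1 - 1; have b0 : 0 < b by rewrite subr_gt0 invf_gt1.
move=> e e0; have eb : 0 < (e * b) by rewrite mulr_gt0.
exists (Num.bound (e * b)^-1) => n hn.
have: (e * b)^-1 < n%:R.
  apply: lt_le_trans (archi_boundP _) _; last by rewrite ler_nat.
  by rewrite invr_ge0 ltW.
move=> h; have en : e^-1 <= `|z| ^- n.
  rewrite -exprVn (_ : `|z|^-1 = 1 + b); last by rewrite /b addrC subrK.
  apply: le_trans (bernoulli_ineq n (ltW b0)).
  apply: le_trans (_ : n%:R * b <= _); last by rewrite lerDr.
  by rewrite -ler_pdivrMr // -invfM ltW.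
by rewrite normrX -lef_pV2 ?posrE ?exprn_gt0.
Qed.

(* Past the threshold where [v] is small, [u] contracts to that level at rate [|z|]. *)
Lemma tends0_affine_rec u v z : `|z| < 1 ->
  (forall n, u n.+1 = z * u n + v n) -> tends0 v -> tends0 u.
Proof.
move=> z1 rec v0 e e0; have r0 : 0 < 1 - `|z| by rewrite subr_gt0.
have e2 : 0 < e / 2 by rewrite divr_gt0.
(* This level makes [e / 2] the fixed point of [t -> |z| * t + level]. *)
have [|N hN] := v0 (e / 2 * (1 - `|z|)); first by rewrite mulr_gt0.
have contr k : `|u (N + k)%N| <= `|z ^+ k * u N| + e / 2.
  elim: k => [|k IHk]; first by rewrite addn0 expr0 mul1r lerDl ltW.
  rewrite addnS rec; apply: le_trans (ler_normD _ _) _.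
  apply: le_trans (lerD (_ : _ <= `|z| * (`|z ^+ k * u N| + e / 2)) (hN _ (leq_addr _ _))) _.
    by rewrite normrM ler_wpM2l.
  rewrite exprS -[z * _ * _]mulrA [`|z * (_ * _)|]normrM mulrDr -addrA lerD2l.
  by rewrite mulrBr mulr1 addrC (mulrC `|z|) subrK.
have zu : tends0 (fun k => z ^+ k * u N).
  by apply: (@tends0_bounded _ (fun=> u N) `|u N|) (tends0_expr z1).
have [M hM] := zu _ e2.
exists (N + M)%N => n hn; rewrite -(subnKC (leq_trans (leq_addr M N) hn)).
apply: le_trans (contr _) _; rewrite [leRHS](splitr e) lerD2r.
by apply: hM; rewrite leq_subRL // (leq_trans (leq_addr M N) hn).
Qed.

(** Consecutive terms differ by a number of constant modulus [|(z - 1) * a|], and these differences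
    tend to zero. *)
Lemma unimodular_expr_tends a b z : `|z| = 1 -> z != 1 ->
  tends0 (fun n => z ^+ n * a - b) -> a = 0.
Proof.
move=> z1 zn1 h.
have: tends0 (fun=> (z - 1) * a).
  apply: tends0_le (tends0D (tends0_shift h) (tends0N h)) => n.
  have -> : z ^+ n.+1 * a - b + - (z ^+ n * a - b) = z ^+ n * ((z - 1) * a).
    by rewrite exprS; ring.
  by rewrite [leRHS]normrM normrX z1 expr1n mul1r.
by move/tends0_const/eqP; rewrite mulf_eq0 subr_eq0 (negPf zn1) /= => /eqP.
Qed.

(** The expression is a coordinate of the orbit of a Jordan chain of length two. Dividing by
    [z ^+ n] leaves [a + n * (b / z)], still bounded by [K], so the linear growth must be absent. *)
Lemma jordan_block_bounded z a b K : 1 <= `|z| ->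
  (forall n, `|z ^+ n * a + n%:R * z ^+ n.-1 * b| <= K) -> b = 0.
Proof.
move=> z1 h; have z0 : z != 0 by rewrite -normr_gt0 (lt_le_trans _ z1).
suff /eqP : b / z = 0 by rewrite mulf_eq0 invr_eq0 (negPf z0) orbF => /eqP.
apply: (@archi_mul_bounded _ (K + `|a|)) => n.
have -> : n%:R * `|b / z| = `|(a + n%:R * (b / z)) - a|.
  by rewrite [a + _]addrC addrK [RHS]normrM normr_nat.
apply: le_trans (ler_normB _ _) _; rewrite lerD2r; apply: le_trans (h n).
have -> : z ^+ n * a + n%:R * z ^+ n.-1 * b = z ^+ n * (a + n%:R * (b / z)).
  case: n => [|n]; first by rewrite !mul0r !addr0.
  by rewrite /= exprS; field.
by rewrite [leRHS]normrM normrX ler_peMl // exprn_ege1.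
Qed.

End NullSequences.

(** * The Hermitian inner product of row vectors *)

Section Dot.
Variables (C : numClosedFieldType) (d : nat).
Implicit Types (x y v : 'rV[C]_d) (T : 'M[C]_d).

Lemma dotmxDl x y v : dotmx (x + y) v = dotmx x v + dotmx y v.
Proof. by rewrite !dotmxE mulmxDl mxE. Qed.

Lemma dotmxC x y : dotmx x y = (dotmx y x)^*.
Proof.
rewrite !dotmxE !mxE rmorph_sum; apply: eq_bigr => i _.
by rewrite !mxE rmorphM /= conjCK mulrC.
Qed.

Lemma dotmxDr x y v : dotmx v (x + y) = dotmx v x + dotmx v y.
Proof. by rewrite dotmxC dotmxDl rmorphD /= -!(dotmxC v). Qed.

Lemma dotmxZl a x v : dotmx (a *: x) v = a * dotmx x v.
Proof. by rewrite !dotmxE -scalemxAl mxE. Qed.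

Lemma dotmxZr a x v : dotmx v (a *: x) = a^* * dotmx v x.
Proof. by rewrite dotmxC dotmxZl rmorphM /= -(dotmxC v). Qed.

Lemma dotmx0l v : dotmx 0 v = 0 :> C.
Proof. by rewrite dotmxE mul0mx mxE. Qed.

Lemma dotmx0r v : dotmx v 0 = 0 :> C.
Proof. by rewrite dotmxC dotmx0l rmorph0. Qed.

Lemma dotmxBl x y v : dotmx (x - y) v = dotmx x v - dotmx y v.
Proof. by rewrite -scaleN1r dotmxDl dotmxZl mulN1r. Qed.

Lemma dotmxBr x y v : dotmx v (x - y) = dotmx v x - dotmx v y.
Proof. by rewrite dotmxC dotmxBl rmorphB /= -!(dotmxC v). Qed.

Lemma dotmx_ge0 x : 0 <= dotmx x x.
Proof.
by have [->|/dotmx_is_dotmx/ltW//] := eqVneq x 0; rewrite dotmx0l.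
Qed.

Lemma dotmx_eq0 x : dotmx x x = 0 -> x = 0.
Proof.
by move=> xx; apply/eqP; apply: contraT => /dotmx_is_dotmx; rewrite xx ltxx.
Qed.

Lemma dotmx_adj x y T : dotmx (x *m T) y = dotmx x (y *m T^t*).
Proof. by rewrite !dotmxE trmx_mul map_mxM /= trmxCK mulmxA. Qed.

Lemma dotmx_sum x y : dotmx x y = \sum_i x 0 i * (y 0 i)^*.
Proof. by rewrite dotmxE mxE; apply: eq_bigr => i _; rewrite !mxE. Qed.

Lemma dotmx_delta T i j :
  dotmx (delta_mx 0 i *m T) (delta_mx 0 j) = T i j.
Proof.
by rewrite dotmxE -rowE trmx_delta map_delta_mx -colE !mxE.
Qed.

End Dot.

(** * Spans of eigenvectors *)

Section EigenvectorSums.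
Variables (F : fieldType) (d : nat) (Q : F -> Prop).
Implicit Types (T : 'M[F]_d) (v w x y z : 'rV[F]_d).

(** The span of the eigenspaces with eigenvalue in [Q], made inductive so that facts about it follow
    one eigenvector at a time. It is used for [|a| = 1] and for [1 < a]. *)
Inductive eigsum T : 'rV[F]_d -> Prop :=
| eigsum0 : eigsum T 0
| eigsumS a v x : Q a -> v *m T = a *: v -> eigsum T x -> eigsum T (v + x).

Lemma eigsumD T x y : eigsum T x -> eigsum T y -> eigsum T (x + y).
Proof.
move=> hx hy; elim: hx => [|a v x' a1 av _ IH]; first by rewrite add0r.
by rewrite -addrA; apply: eigsumS a1 av IH.
Qed.

Lemma eigsumZ T a x : eigsum T x -> eigsum T (a *: x).
Proof.
elim=> [|b v x' b1 bv _ IH]; first by rewrite scaler0; constructor.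
rewrite scalerDr; apply: eigsumS b1 _ IH.
by rewrite -scalemxAl bv !scalerA mulrC.
Qed.

Lemma eigsum1 T a v : Q a -> v *m T = a *: v -> eigsum T v.
Proof. by move=> a1 av; rewrite -[v]addr0; apply: eigsumS a1 av (eigsum0 _). Qed.

(** On an eigenvector for [b != a], [T - a] is the nonzero scalar [b - a] and can be inverted; the
    eigenvectors for [a] itself are collected in [w]. *)
Lemma eigsum_sub_scalar T a y : eigsum T y ->
  exists w z, [/\ w *m T = a *: w, eigsum T z & y = z *m (T - a%:M) + w].
Proof.
elim=> [|b v x b1 bv _ [w [z [aw hz ->]]]].
  exists 0, 0; rewrite !mul0mx scaler0 addr0; split=> //; exact: eigsum0.
have [ba|ba] := eqVneq b a.
  exists (v + w), z; split=> //; first by rewrite mulmxDl aw bv ba scalerDr.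
  by rewrite addrCA.
exists w, ((b - a)^-1 *: v + z); split=> //.
  by apply: eigsumD hz; apply/eigsumZ/(eigsum1 b1 bv).
rewrite mulmxDl -addrA; congr (_ + _).
rewrite -scalemxAl mulmxBr bv mul_mx_scalar -scalerBl scalerA mulVf ?scale1r //.
by rewrite subr_eq0.
Qed.

End EigenvectorSums.

(** * Power bounded matrices *)

Section PowerBounded.
Variables (C : archiClosedFieldType) (d : nat).
Implicit Types (T P L : 'M[C]_d) (x y v w s u : 'rV[C]_d).

Definition entries_bounded T :=
  exists K, forall n i j, `|(T ^+ n) i j| <= K.

Definition mx_tends (S : nat -> 'M[C]_d) L :=
  forall i j, tends0 (fun n => S n i j - L i j).

(* In the row vector convention this is the matrix of [T^*n T^n]. *)
Definition gram T n := T ^+ n *m (T ^+ n)^t*.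

Definition unimodular_orthogonal T := forall a b x y,
  `|a| = 1 -> `|b| = 1 -> a != b ->
  x *m T = a *: x -> y *m T = b *: y -> dotmx x y = 0.

Definition unimodular (a : C) : Prop := `|a| = 1.

Definition row_stable T x := forall j, tends0 (fun n => (x *m T ^+ n) 0 j).


Lemma mulmx_exprS x T n : x *m T ^+ n.+1 = x *m T *m T ^+ n.
Proof. by rewrite exprS -mulmxA. Qed.

Lemma row_bounded T x : entries_bounded T ->
  exists K, forall n j, `|(x *m T ^+ n) 0 j| <= K.
Proof.
move=> [K hK]; exists (\sum_i `|x 0 i| * K) => n j; rewrite mxE.
apply: le_trans (ler_norm_sum _ _ _) _; apply: ler_sum => i _.
by rewrite normrM ler_wpM2l.
Qed.

Lemma row_stable0 T : row_stable T 0.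
Proof.
by move=> j; apply: eq_tends0 (@tends0_0 C) => n; rewrite mul0mx mxE.
Qed.

Lemma row_stableD T x y : row_stable T x -> row_stable T y -> row_stable T (x + y).
Proof.
move=> hx hy j; apply: eq_tends0 (tends0D (hx j) (hy j)) => n.
by rewrite mulmxDl mxE.
Qed.

Lemma row_stableZ T a x : row_stable T x -> row_stable T (a *: x).
Proof.
move=> hx j; apply: eq_tends0 (tends0Z a (hx j)) => n.
by rewrite -scalemxAl mxE.
Qed.

(** A product of linear factors of [T] acting on [x], arranged so that induction on [l] peels off
    the factor applied first. *)
Definition kill T (l : seq C) x := foldl (fun y z => y *m (T - z%:M)) x l.

(** By induction [x *m (T - z)] is stable; the coordinates of [x *m T ^+ n] then satisfy an affine
    recurrence of ratio [z] with null forcing term. *)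
Lemma kill_stable T l x : all (fun z => `|z| < 1) l -> kill T l x = 0 ->
  row_stable T x.
Proof.
elim: l x => [|z l IHl] x /=; first by move=> _ ->; apply: row_stable0.
move=> /andP[z1 hl] /(IHl _ hl) hy j.
apply: (tends0_affine_rec z1 _ (hy j)) => n.
have xT : x *m T = z *: x + x *m (T - z%:M).
  by rewrite mulmxBr mul_mx_scalar addrC subrK.
by rewrite mulmx_exprS {1}xT mulmxDl -scalemxAl mxE; congr (_ + _); rewrite mxE.
Qed.

Lemma jordan_expr T a x w n : x *m T = a *: x + w -> w *m T = a *: w ->
  x *m T ^+ n = a ^+ n *: x + (n%:R * a ^+ n.-1) *: w.
Proof.
move=> xT wT; elim: n => [|n IHn].
  by rewrite expr0 mulmx1 scale1r mul0r scale0r addr0.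
rewrite [x *m _](_ : _ = x *m T ^+ n *m T); last by rewrite exprSr -mulmxA.
rewrite IHn mulmxDl -!scalemxAl xT wT.
rewrite scalerDr !scalerA -exprSr -addrA -scalerDl; congr (_ + _ *: _).
by case: n {IHn} => [|n]; rewrite /= ?exprS -?natr1; ring.
Qed.

Lemma eigenvector_expr T a v n : v *m T = a *: v -> v *m T ^+ n = a ^+ n *: v.
Proof. by move=> av; rewrite (@jordan_expr _ a v 0) ?mul0mx ?scaler0 ?addr0. Qed.

(** By induction [x *m (T - a)] is a sum of unimodular eigenvectors. Subtracting a suitable such sum
    [z] from [x] leaves a Jordan chain of length at most two for [a]; boundedness of the orbit kills
    its eigenvector [w], so that [x - z] satisfies the eigenvalue equation for [a]. *)
Lemma kill_eigsum T l x : entries_bounded T ->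
  all (fun z => 1 <= `|z|) l -> kill T l x = 0 -> eigsum unimodular T x.
Proof.
move=> bT; elim: l x => [|a l IHl] x /=; first by move=> _ ->; apply: eigsum0.
move=> /andP[a1 hl] /(IHl _ hl) /(eigsum_sub_scalar a)[w [z [aw hz]]].
move=> xz; have {}xz : (x - z) *m (T - a%:M) = w.
  by rewrite mulmxBl xz addrAC subrr add0r.
rewrite -(subrK z x); apply: eigsumD hz; move: (x - z) xz => {}x xw.
have {xw} xT : x *m T = a *: x + w.
  by rewrite -xw mulmxBr mul_mx_scalar addrC subrK.
have [K hK] := row_bounded x bT.
have w0 : w = 0.
  apply/rowP => j; rewrite [RHS]mxE.
  apply: (@jordan_block_bounded _ a (x 0 j) _ K a1) => n.
  by have := hK n j; rewrite (jordan_expr n xT aw) !mxE.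
have ax : x *m T = a *: x by rewrite xT w0 addr0.
case: (eqVneq `|a| 1) => [an1|an1]; first exact: eigsum1 an1 ax.
(* Here [|a| > 1], and a bounded orbit forces the vector to vanish. *)
suff -> : x = 0 by apply: eigsum0.
apply/rowP => j; rewrite [RHS]mxE.
apply: (@expr_bounded_eq0 _ a _ K); first by rewrite lt_def an1.
by move=> n; have := hK n j; rewrite (jordan_expr n xT aw) w0 scaler0 addr0 !mxE.
Qed.

End PowerBounded.

Arguments unimodular {C} a.

(** * The stable-unimodular decomposition and the limit of the Gram matrices *)

Section Limit.
Variables (C : archiClosedFieldType) (d : nat).
Implicit Types (T P L : 'M[C]_d) (x y v w s u : 'rV[C]_d).

Lemma horner_mx_kill n (T : 'M[C]_n.+1) l (x : 'rV_n.+1) :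
  x *m horner_mx T (\prod_(z <- l) ('X - z%:P)) = kill T l x.
Proof.
elim: l x => [|z l IHl] x; first by rewrite big_nil rmorph1 mulmx1.
by rewrite big_cons rmorphM /= mulmxA IHl rmorphB /= horner_mx_X horner_mx_C.
Qed.

(** The characteristic polynomial factors as [q * b], with the roots inside the open disc in [q] and
    the others in [b]. A Bezout identity [f * q + g * b = 1] splits [x], and by Cayley-Hamilton [q]
    kills the [g * b] part while [b] kills the [f * q] part. *)
Lemma stable_eigsum_decomposition T x : entries_bounded T ->
  exists s u, [/\ x = s + u, row_stable T s & eigsum unimodular T u].
Proof.
(* [horner_mx] requires a matrix ring of size [n.+1], so dimension zero is settled apart. *)
case: d T x => [|n] T x bT.
  exists 0, 0; split; [by rewrite !thinmx0|exact: row_stable0|exact: eigsum0].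
have [l pl] := closed_field_poly_normal (char_poly T).
rewrite (monicP (char_poly_monic T)) scale1r in pl.
pose small := [seq z <- l | `|z| < 1]; pose big := [seq z <- l | ~~ (`|z| < 1)].
pose q := \prod_(z <- small) ('X - z%:P); pose b := \prod_(z <- big) ('X - z%:P).
have qb0 : horner_mx T q *m horner_mx T b = 0.
  rewrite -[_ *m _](rmorphM (horner_mx T)).
  suff -> : q * b = char_poly T by apply: Cayley_Hamilton.
  by rewrite pl (bigID (fun z => `|z| < 1)) /q /b !big_filter.
have bq0 : horner_mx T b *m horner_mx T q = 0.
  by rewrite -[_ *m _](rmorphM (horner_mx T)) mulrC rmorphM.
have: coprimep q b.
  have: all (fun z => ~~ (`|z| < 1)) big by exact: filter_all.
  rewrite /b; elim: (big) => [_|z m IHm].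
    by rewrite big_nil coprimep1.
  move=> /= /andP[z1 hm]; rewrite big_cons coprimepMr IHm // andbT.
  rewrite coprimep_XsubC root_prod_XsubC mem_filter.
  by rewrite (negPf z1).
case/Bezout_eq1_coprimepP => -[f g] /= fg.
exists (x *m horner_mx T (g * b)), (x *m horner_mx T (f * q)); split.
- by rewrite -mulmxDr -rmorphD addrC /= fg rmorph1 mulmx1.
- apply: (@kill_stable _ _ _ small); first exact: filter_all.
  by rewrite -horner_mx_kill -/q rmorphM /= -!mulmxA bq0 !mulmx0.
- apply: (@kill_eigsum _ _ _ big) => //.
    apply/allP => z; rewrite mem_filter real_ltNge ?real1 ?normr_real // negbK.
    by case/andP.
  by rewrite -horner_mx_kill -/b rmorphM /= -!mulmxA qb0 !mulmx0.
Qed.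

(** Expanding both sums, pairs with distinct eigenvalues are orthogonal, and pairs with the same
    eigenvalue acquire the factor [|a ^+ n| ^+ 2 = 1]. *)
Lemma eigsum_isometry T x y n : unimodular_orthogonal T ->
  eigsum unimodular T x -> eigsum unimodular T y ->
  dotmx (x *m T ^+ n) (y *m T ^+ n) = dotmx x y.
Proof.
move=> orthT hx hy.
elim: hx => [|a v x' a1 av _ IHx]; first by rewrite mul0mx !dotmx0l.
rewrite mulmxDl !dotmxDl {}IHx; congr (_ + _).
elim: hy => [|b w y' b1 bw _ IHy]; first by rewrite mul0mx !dotmx0r.
rewrite mulmxDl !dotmxDr {}IHy; congr (_ + _).
rewrite (eigenvector_expr n av) (eigenvector_expr n bw) dotmxZl dotmxZr.
have [ab|ab] := eqVneq a b; last by rewrite (orthT a b) // !mulr0.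
by rewrite ab mulrA -normCK normrX b1 !expr1n mul1r.
Qed.

Lemma dotmx_stable T x y : entries_bounded T -> row_stable T x ->
  tends0 (fun n => dotmx (x *m T ^+ n) (y *m T ^+ n)).
Proof.
move=> bT sx; have [K hK] := row_bounded y bT.
apply: eq_tends0 (fun n => dotmx_sum _ _) _.
apply: tends0_sum => i; apply: (@tends0_bounded _ _ _ K) => // n.
by rewrite norm_conjC.
Qed.

Lemma unimodular_projection T : entries_bounded T -> unimodular_orthogonal T ->
  exists P, P *m P = P /\ forall x, row_stable T (x - x *m P) /\ eigsum unimodular T (x *m P).
Proof.
move=> bT orthT.
have /fin_all_exists[f hf] : forall i : 'I_d, exists u,
    row_stable T (delta_mx 0 i - u) /\ eigsum unimodular T u.
  move=> i; have [s [u [-> hs hu]]] := stable_eigsum_decomposition (delta_mx 0 i) bT.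
  by exists u; rewrite addrK.
(* The rows of [P] are the unimodular parts of the basis vectors; the decomposition extends to every
   [x] by linearity. *)
pose P := \matrix_i f i.
have hP x : row_stable T (x - x *m P) /\ eigsum unimodular T (x *m P).
  rewrite {1}(row_sum_delta x) mulmx_sum_row -sumrB; split.
    apply: big_ind => [|y z|i _]; [exact: row_stable0|exact: row_stableD|].
    by rewrite -scalerBr rowK; apply: row_stableZ; case: (hf i).
  apply: big_ind => [|y z|i _]; [exact: eigsum0|exact: eigsumD|].
  by rewrite rowK; apply: eigsumZ; case: (hf i).
exists P; split=> //; apply/row_matrixP => i; rewrite row_mul.
rewrite rowE -mulmxA; set u := delta_mx 0 i *m P; rewrite mulmxA -/u.
have [su eu] := hP u; have [_ ei] := hP (delta_mx 0 i).
(* The vector [u - u *m P] is both stable and a sum of unimodular eigenvectors: its norm is constant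
   along the orbit and tends to zero. *)
apply/eqP; rewrite eq_sym -subr_eq0; apply/eqP/dotmx_eq0/tends0_const.
have ee : eigsum unimodular T (u - u *m P).
  by apply: eigsumD ei _; rewrite -scaleN1r; apply: eigsumZ.
apply: eq_tends0 (dotmx_stable (u - u *m P) bT su) => n.
by rewrite (eigsum_isometry n orthT ee ee).
Qed.

Lemma dotmx_gram T x y n :
  dotmx (x *m gram T n) y = dotmx (x *m T ^+ n) (y *m T ^+ n).
Proof. by rewrite /gram mulmxA dotmx_adj trmxCK. Qed.

(** Replacing [x] by [x *m P], then [y] by [y *m P], in [<x T^n, y T^n>] costs two terms, each
    pairing a stable orbit with a bounded one. What remains is [<xP, yP>] by isometry. *)
Lemma gram_tends T P : entries_bounded T -> unimodular_orthogonal T ->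
  (forall x, row_stable T (x - x *m P) /\ eigsum unimodular T (x *m P)) ->
  mx_tends (gram T) (P *m P^t*).
Proof.
move=> bT orthT hP i j.
pose x : 'rV[C]_d := delta_mx 0 i; pose y : 'rV[C]_d := delta_mx 0 j.
have [sx ex] := hP x; have [sy ey] := hP y.
have sxy := dotmx_stable y bT sx.
have syx := tends0_conj (dotmx_stable (x *m P) bT sy).
apply: eq_tends0 (tends0D sxy syx) => n.
rewrite -(dotmx_delta (gram T n)) -(dotmx_delta (P *m _)) dotmx_gram -/x -/y.
rewrite mulmxA (dotmx_adj (x *m P)) trmxCK -(eigsum_isometry n orthT ex ey).
rewrite -(dotmxC (x *m P *m _)) !mulmxBl dotmxBl dotmxBr.
by rewrite addrA subrK.
Qed.

Lemma mx_tends_dotmx (S : nat -> 'M[C]_d) L x y : mx_tends S L ->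
  tends0 (fun n => dotmx (x *m S n) y - dotmx (x *m L) y).
Proof.
move=> SL; pose F j i n := (S n i j - L i j) * (x 0 i * (y 0 j)^*).
have F0 : tends0 (fun n => \sum_j \sum_i F j i n).
  apply: tends0_sum => j; apply: tends0_sum => i.
  by apply: (@tends0_bounded _ _ (fun=> _) `|x 0 i * (y 0 j)^*| _ (SL i j)).
apply: eq_tends0 F0 => n; rewrite -dotmxBl -mulmxBr dotmx_sum.
apply: eq_bigr => j _; rewrite mxE mulr_suml; apply: eq_bigr => i _.
by rewrite /F !mxE mulrCA mulrA.
Qed.

Lemma mx_tends_unique (S : nat -> 'M[C]_d) L M :
  mx_tends S L -> mx_tends S M -> L = M.
Proof.
move=> SL SM; apply/matrixP => i j; apply/eqP; rewrite -subr_eq0; apply/eqP.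
apply: tends0_const; apply: eq_tends0 (tends0D (SM i j) (tends0N (SL i j))) => n.
by ring.
Qed.

Lemma gram_cvg_orthogonal T L : mx_tends (gram T) L -> unimodular_orthogonal T.
Proof.
move=> TL a b x y a1 b1 ab ax bxy.
have b0 : b != 0 by rewrite -normr_eq0 b1 oner_eq0.
have bb : b^-1 = b^*.
  by apply: (mulfI b0); rewrite divff // -normCK b1 expr1n.
apply: (@unimodular_expr_tends _ _ (dotmx (x *m L) y) (a / b)).
- by rewrite normrM normfV a1 b1 invr1 mulr1.
- by apply: contra ab => /eqP h; rewrite -(divfK b0 a) h mul1r.
apply: eq_tends0 (mx_tends_dotmx x y TL) => n; congr (_ - _).
rewrite dotmx_gram (eigenvector_expr n ax) (eigenvector_expr n bxy) dotmxZl dotmxZr mulrA.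
by rewrite bb exprMn rmorphXn.
Qed.

Theorem gram_converges_iff T : entries_bounded T ->
  (exists L, mx_tends (gram T) L) <-> unimodular_orthogonal T.
Proof.
move=> bT; split=> [[L]|orthT]; first exact: gram_cvg_orthogonal.
have [P [_ hP]] := unimodular_projection bT orthT.
by exists (P *m P^t*); apply: gram_tends.
Qed.

Theorem gram_limit_idempotent L :
  (exists2 T, entries_bounded T & mx_tends (gram T) L) <->
  (exists2 P, P *m P = P & P *m P^t* = L).
Proof.
split=> [[T bT TL]|[P PP <-]].
  have orthT := gram_cvg_orthogonal TL.
  have [P [PP hP]] := unimodular_projection bT orthT.
  by exists P => //; apply: mx_tends_unique (gram_tends bT orthT hP) TL.
have PX n : P ^+ n.+1 = P.
  by elim: n => [|n IHn]; rewrite ?expr1 // exprS IHn.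
exists P => [|i j].
  (* [P] itself serves as [T]; the summand 1 covers the identity matrix at [n = 0]. *)
  exists (\sum_i \sum_j (`|P i j| + 1)) => n i j.
  rewrite (bigD1 i) //= (bigD1 j) //= -addrA ler_wpDr //.
    by rewrite addr_ge0 // ?sumr_ge0 // => *; rewrite ?sumr_ge0 // => *; rewrite addr_ge0.
  case: n => [|n]; last by rewrite PX lerDl.
  rewrite expr0 mxE; case: (i == j); last by rewrite normr0 addr_ge0.
  by rewrite normr1 lerDr.
apply: (@tends0_eventually _ _ (fun=> 0) 1 _ (@tends0_0 C)) => -[//|n] _.
by rewrite /gram PX subrr.
Qed.

End Limit.

(** * Idempotents and spectra *)

(** [E] selects the coordinates where [D] is nonzero and [N] divides by [D] there, so the identity
    of size [#|X|] factors through [diag_mx D]. *)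
Lemma rank_diag_mx_ge (F : fieldType) n (D : 'rV[F]_n) :
  (#|[pred i | D 0%R i != 0%R]| <= \rank (diag_mx D))%N.
Proof.
set X := [pred i | D 0 i != 0].
pose E := \matrix_(k < #|X|, j < n) ((enum_val k == j)%:R : F).
pose N := \matrix_(j < n, k < #|X|) ((j == enum_val k)%:R / D 0 j : F).
have EDN : E *m (diag_mx D *m N) = 1%:M.
  apply/matrixP => k l; rewrite mxE (bigD1 (enum_val k)) //= big1 => [|j].
    rewrite !mxE eqxx mul1r addr0 (bigD1 (enum_val k)) //= big1 => [|j].
      rewrite !mxE eqxx mulr1n addr0 mulrCA mulfV ?mulr1.
        by rewrite (inj_eq enum_val_inj).
      by have := enum_valP k; rewrite inE.
    by rewrite !mxE eq_sym => /negPf->; rewrite mulr0n mul0r.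
  by rewrite !mxE eq_sym => /negPf->; rewrite mul0r.
rewrite -[X in (X <= _)%N](mxrank1 F) -EDN.
by apply: leq_trans (mxrankM_maxr _ _) (mxrankM_maxl _ _).
Qed.

Lemma injection_of_card (T : finType) (X Y : {pred T}) : (#|X| <= #|Y|)%N ->
  exists f : T -> T, {in X &, injective f} /\ {in X, forall i, f i \in Y}.
Proof.
move=> XY; exists (fun i => nth i (enum Y) (index i (enum X))).
have lt i : i \in X -> (index i (enum X) < size (enum Y))%N.
  by move=> iX; rewrite -cardE; apply: leq_trans XY; rewrite cardE index_mem mem_enum.
split=> [i j iX jX|i iX]; last by rewrite -mem_enum mem_nth ?lt.
(* The default value of [nth] is the argument itself, so the two defaults must agree before
   uniqueness applies. *)
rewrite (set_nth_default j) ?lt //.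
move/eqP; rewrite nth_uniq ?lt ?enum_uniq // => /eqP.
move=> ij; have iX' : i \in enum X by rewrite mem_enum.
by rewrite -(nth_index i iX') ij nth_index // mem_enum.
Qed.

Section Spectral.
Variables (C : numClosedFieldType) (d : nat).
Implicit Types (A P S : 'M[C]_d) (D : 'rV[C]_d) (x y v w : 'rV[C]_d) (a : C).

(** In the order of [C] this inequality includes that the value is real. *)
Definition psd A := forall x, 0 <= dotmx (x *m A) x.

(** Polarization: [x + y] gives [<xA, y> + <yA, x> = 0], and [x + 'i y] gives
    [<xA, y> = <yA, x>]. *)
Lemma dotmx_diag0_eq0 A : (forall x, dotmx (x *m A) x = 0) -> A = 0.
Proof.
move=> A0.
have sum0 x y : dotmx (x *m A) y + dotmx (y *m A) x = 0.
  have := A0 (x + y); rewrite mulmxDl dotmxDl !dotmxDr !A0.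
  by rewrite add0r addr0.
apply/matrixP => i j; rewrite mxE -dotmx_delta.
set x := delta_mx 0 i; set y := delta_mx 0 j.
have h1 := sum0 x y; have := sum0 x ('i *: y).
rewrite -scalemxAl dotmxZl dotmxZr conjCi mulNr addrC => /eqP.
rewrite subr_eq0 => /eqP/(mulfI (neq0Ci C)) h2; move: h1; rewrite h2.
by move/eqP; rewrite -mulr2n mulrn_eq0 => /eqP.
Qed.

Lemma psd_hermitian A : psd A -> A^t* = A.
Proof.
move=> Apos; apply/eqP; rewrite -subr_eq0; apply/eqP/dotmx_diag0_eq0 => x.
rewrite mulmxBr dotmxBl dotmx_adj trmxCK dotmxC.
by rewrite (CrealP (ger0_real (Apos x))) subrr.
Qed.

Lemma hermitian_diagonalization A : A^t* = A ->
  exists S D, [/\ S *m S^t* = 1%:M, S^t* *m S = 1%:M & A = S^t* *m diag_mx D *m S].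
Proof.
move=> hA; have /hermitian_normalmx/orthomx_spectralP : A \is hermsymmx.
  by apply/is_hermitianmxP; rewrite expr0 scale1r hA.
have U := spectral_unitarymx A.
exists (spectralmx A), (spectral_diag A); split; first exact/unitarymxP.
  by rewrite -invmx_unitary // mulVmx // unitarymx_unit.
by rewrite -invmx_unitary.
Qed.

(** * Kernel and spectral subspace of a unitarily diagonalized matrix *)

Section Diagonalized.
Variables (A S : 'M[C]_d) (D : 'rV[C]_d).
Hypotheses (SS : S *m S^t* = 1%:M) (SS' : S^t* *m S = 1%:M).
Hypothesis AE : A = S^t* *m diag_mx D *m S.

(** The rows of [S] form an orthonormal eigenbasis. Those with eigenvalue at most 1 are zeroed, so
    the row space is the range of [E(]1,oo[)]. *)
Definition gt1_basis := diag_mx (\row_i (1 < D 0 i)%R%:R) *m S.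

Lemma row_diag_mul i (B : 'M[C]_d) (E : 'rV[C]_d) :
  row i (diag_mx E *m B) = E 0 i *: row i B.
Proof. by apply/rowP => j; rewrite mxE mul_diag_mx !mxE. Qed.

Lemma diag_intertwine : S *m A = diag_mx D *m S.
Proof. by rewrite AE !mulmxA SS mul1mx. Qed.

Lemma diag_row_eigen i : row i S *m A = D 0 i *: row i S.
Proof. by rewrite -row_mul diag_intertwine row_diag_mul. Qed.

Lemma diag_coord_eigen v a j : v *m A = a *: v ->
  (v *m S^t*) 0 j != 0 -> D 0 j = a.
Proof.
move=> av vj; have /rowP/(_ j) : v *m S^t* *m diag_mx D = a *: (v *m S^t*).
  by rewrite scalemxAl -av AE -!mulmxA SS mulmx1.
by rewrite mul_mx_diag mxE [RHS]mxE mulrC => /(mulIf vj).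
Qed.

Lemma sub_gt1_basisP x :
  reflect (forall i, (x *m S^t*) 0 i != 0 -> 1 < D 0 i) (x <= gt1_basis)%MS.
Proof.
apply: (iffP submxP) => [[w ->] i|h].
  rewrite /gt1_basis -!mulmxA SS mulmx1 mul_mx_diag mxE [X in _ * X]mxE.
  by case: (1 < D 0 i) => //; rewrite mulr0 eqxx.
exists (x *m S^t*); rewrite mulmxA -[LHS]mulmx1 -SS' mulmxA; congr (_ *m _).
apply/rowP => i; rewrite mul_mx_diag [RHS]mxE [X in _ * X]mxE.
have [->|/h ->] := eqVneq ((x *m S^t*) 0 i) 0; first by rewrite mul0r.
by rewrite mulr1.
Qed.

Lemma gt1_basisP x : (x <= gt1_basis)%MS <-> eigsum (fun a => 1 < a) A x.
Proof.
split=> [/submxP[w ->]|].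
  rewrite mulmx_sum_row.
  apply: big_ind => [|y z|i _]; [exact: eigsum0|exact: eigsumD|].
  apply: eigsumZ; rewrite row_diag_mul mxE.
  case: (boolP (1 < D 0 i)) => [Di|_]; last by rewrite scale0r; exact: eigsum0.
  by rewrite scale1r; apply: (@eigsum1 _ _ (fun a => 1 < a) _ _ _ Di); apply: diag_row_eigen.
elim=> [|a v y a1 av _ IH]; first exact: sub0mx.
apply: addmx_sub IH; apply/sub_gt1_basisP => i.
by move/(diag_coord_eigen av) ->.
Qed.

Lemma diag_eigenvalue i : A - (D 0 i)%:M \notin unitmx.
Proof.
apply/negP => U; have r0 : row i S = 0.
  apply: (can_inj (mulmxK U)); rewrite mul0mx mulmxBr diag_row_eigen.
  by rewrite mul_mx_scalar subrr.
have /row_matrixP/(_ i)/rowP/(_ i) := SS.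
by rewrite row_mul r0 mul0mx !mxE eqxx => /esym/eqP; rewrite oner_eq0.
Qed.

Lemma dotmx_diag x :
  dotmx (x *m A) x = \sum_i D 0 i * ((x *m S^t*) 0 i * ((x *m S^t*) 0 i)^*).
Proof.
rewrite AE !mulmxA dotmx_adj dotmx_sum; apply: eq_bigr => i _.
by rewrite mul_mx_diag mxE mulrCA mulrA.
Qed.

Lemma dotmx_unitary x :
  dotmx x x = \sum_i ((x *m S^t*) 0 i * ((x *m S^t*) 0 i)^*).
Proof. by rewrite -dotmx_sum dotmx_adj trmxCK -mulmxA SS' mulmx1. Qed.

Lemma rank_kermx_diag :
  (\rank (kermx A) <= #|[pred i | D 0%R i == 0%R]|)%N.
Proof.
rewrite mxrank_ker; have -> : \rank A = \rank (diag_mx D).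
  have uS : S \in unitmx by apply: (mulmx1_unit SS).1.
  have uS' : S^t* \in unitmx by apply: (mulmx1_unit SS').1.
  by rewrite AE mxrankMfree ?row_free_unit // eqmxMfull ?row_full_unit.
rewrite leq_subLR addnC -[leqLHS]card_ord -(cardC [pred i | D 0%R i == 0%R]).
by rewrite leq_add2l rank_diag_mx_ge.
Qed.

Lemma rank_gt1_basis_ge :
  (#|[pred i | (1 < D 0%R i)%R]| <= \rank gt1_basis)%N.
Proof.
have uS : S \in unitmx by apply: (mulmx1_unit SS).1.
rewrite mxrankMfree ?row_free_unit //.
apply: leq_trans (rank_diag_mx_ge _); apply: subset_leq_card.
by apply/subsetP => i; rewrite !inE mxE => ->; rewrite oner_eq0.
Qed.

End Diagonalized.

Lemma psd_gt1_space A : psd A ->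
  exists W : 'M[C]_d, forall x, (x <= W)%MS <-> eigsum (fun a => 1 < a) A x.
Proof.
move=> /psd_hermitian/hermitian_diagonalization[S [D [SS SS' AE]]].
by exists (gt1_basis S D) => x; apply: gt1_basisP.
Qed.

(** Dimensions appear as ranks: [W] is any matrix whose row space is the range of [E(]1,oo[)]. The
    bound [1 <= a] also makes [a] real. *)
Definition spectral_conditions A :=
  [/\ psd A,
      forall a, A - a%:M \notin unitmx -> a = 0 \/ 1 <= a &
      exists2 W : 'M[C]_d,
        (forall x, (x <= W)%MS <-> eigsum (fun a => 1 < a) A x) &
        (\rank W <= \rank (kermx A))%N].

Lemma nonunitmxP A : A \notin unitmx -> exists2 v : 'rV_d, v != 0 & v *m A = 0.
Proof.
rewrite -row_free_unit -kermx_eq0 => /rowV0Pn[v /sub_kermxP vA v0].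
by exists v.
Qed.

Lemma idempotent_spectral P : P *m P = P -> spectral_conditions (P *m P^t*).
Proof.
move=> PP; set A := P *m P^t*.
have dotA x : dotmx (x *m A) x = dotmx (x *m P) (x *m P).
  by rewrite mulmxA dotmx_adj trmxCK.
have Apos : psd A by move=> x; rewrite dotA dotmx_ge0.
have P'P' : P^t* *m P^t* = P^t* by rewrite -map_mxM -trmx_mul PP.
have [S [D [SS SS' AE]]] := hermitian_diagonalization (psd_hermitian Apos).
split=> // [a /nonunitmxP[v v0]|].
  rewrite mulmxBr mul_mx_scalar => /eqP; rewrite subr_eq0 => /eqP av.
  have [->|a0] := eqVneq a 0; [by left|right].
  (* The vector [a *: v = v *m P *m P^t*] lies in the range of the idempotent [P^t*]. *)
  have vP' : v *m P^t* = v.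
    apply: (scalerI a0); rewrite scalemxAl -av -!mulmxA P'P'.
    by rewrite mulmxA.
  have vv : dotmx v v = dotmx (v *m P) v by rewrite dotmx_adj vP'.
  have vv' : dotmx v v = dotmx v (v *m P) by rewrite [RHS]dotmxC -vv -dotmxC.
  (* Expanded, this square norm is [(a - 1) * dotmx v v]. *)
  have := dotmx_ge0 (v - v *m P).
  rewrite dotmxBl !dotmxBr -vv -vv' subrr sub0r opprB -dotA av dotmxZl.
  by rewrite -[X in _ - X]mul1r -mulrBl pmulr_lge0 ?dotmx_is_dotmx // subr_ge0.
exists (gt1_basis S D); first exact: gt1_basisP.
(* The range of [1 - P] is killed by [A], so it suffices that [1 - P] is injective on the row space
   of [gt1_basis]. *)
apply: (@leq_trans (\rank (1%:M - P))); last first.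
  by apply/mxrankS/sub_kermxP; rewrite mulmxA mulmxBl mul1mx PP subrr mul0mx.
apply: leq_trans (mxrankM_maxr (gt1_basis S D) _).
have /mxrank_injP-> // : (gt1_basis S D :&: kermx (1%:M - P))%MS == 0.
apply/rowV0P => x; rewrite sub_capmx => /andP[].
move=> /(sub_gt1_basisP D SS SS') xgt /sub_kermxP; rewrite mulmxBr mulmx1.
move=> /eqP; rewrite subr_eq0 => /eqP xP.
pose c := x *m S^t*.
(* Since [x *m P = x], the forms [<xA, x>] and [<x, x>] agree. Their difference is the sum of these
   nonnegative terms. *)
have c0 i : (D 0 i - 1) * (c 0 i * (c 0 i)^*) = 0.
  apply: (@psumr_eq0P _ _ xpredT (fun i => (D 0 i - 1) * (c 0 i * (c 0 i)^*))) => //.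
    move=> j _; have [->|/xgt Dj] := eqVneq (c 0 j) 0; first by rewrite mul0r mulr0.
    by rewrite mulr_ge0 ?mul_conjC_ge0 // subr_ge0 ltW.
  under eq_bigr do rewrite mulrBl mul1r.
  by rewrite sumrB -(dotmx_diag AE) -(dotmx_unitary SS') dotA -xP subrr.
rewrite -[x]mulmx1 -SS' mulmxA -/c.
suff -> : c = 0 by rewrite mul0mx.
apply/rowP => i; rewrite [RHS]mxE; apply/eqP; apply: contraT => ci.
have /xgt Di := ci; have /eqP := c0 i.
by rewrite mulf_eq0 mul_conjC_eq0 (negPf ci) orbF subr_eq0 gt_eqF.
Qed.

(* [Q] sends a basis vector with [D i > 1] to itself plus [sqrt (D i - 1)] times a kernel
   vector reserved for it; this uses as many kernel vectors as there are such [i]. *)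
Lemma diag_idempotent D :
  (forall i, D 0 i = 0 \/ 1 <= D 0 i) ->
  (#|[pred i | (1 < D 0%R i)%R]| <= #|[pred i | D 0%R i == 0%R]|)%N ->
  exists2 Q : 'M[C]_d, Q *m Q = Q & Q *m Q^t* = diag_mx D.
Proof.
move=> D01 /injection_of_card[f [f_inj f_ker]].
pose r i := sqrtC (D 0 i - 1).
pose e i : 'rV[C]_d := delta_mx 0 i.
pose q i := if D 0 i == 0 then 0 else e i + r i *: e (f i).
(* For [D 0 i = 1] the coefficient vanishes, which hides the uncontrolled value [f i]. *)
have r_gt1 i : D 0 i != 0 -> r i = 0 \/ (1 < D 0 i /\ D 0 (f i) = 0).
  case: (D01 i) => [->|]; first by rewrite eqxx.
  rewrite le_eqVlt => /orP[/eqP Di _|Di _]; last first.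
    by right; split=> //; apply/eqP; apply: f_ker.
  by left; rewrite /r -Di subrr sqrtC0.
have ee i j : dotmx (e i) (e j) = (i == j)%:R.
  rewrite dotmx_sum (bigD1 i) //= big1 => [|k /negPf ki]; rewrite !mxE ?ki ?mul0r //.
  by rewrite !eqxx mul1r addr0 conjC_nat.
exists (\matrix_i q i).
  apply/row_matrixP => i; rewrite row_mul !rowK /q.
  case: ifP => [_|/negbT Di]; first by rewrite mul0mx.
  rewrite mulmxDl -scalemxAl -!rowE !rowK /q (negPf Di).
  have [->|[_ ->]] := r_gt1 i Di; first by rewrite !scale0r !addr0.
  by rewrite eqxx scaler0 addr0.
apply/matrixP => i k; rewrite [RHS]mxE.
have -> : (\matrix_i q i *m (\matrix_i q i)^t*) i k = dotmx (q i) (q k).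
  rewrite dotmx_sum mxE; apply: eq_bigr => j _; by rewrite !mxE.
rewrite /q; case: ifP => [/eqP ->|/negbT Di]; first by rewrite dotmx0l mul0rn.
case: ifP => [/eqP Dk|/negbT Dk].
  by rewrite dotmx0r; have [ik|//] := eqVneq i k; rewrite ik Dk mul0rn.
(* Cross terms vanish because a reserved index [f j] lies in the kernel and [l] does not. *)
have re0 j l : D 0 j != 0 -> D 0 l != 0 -> r j * (f j == l)%:R = 0.
  move=> Dj Dl; have [->|[_ Df]] := r_gt1 j Dj; first by rewrite mul0r.
  by have [fl|_] := eqVneq (f j) l; [rewrite -fl Df eqxx in Dl|rewrite mulr0].
rewrite !dotmxDl !dotmxDr !dotmxZl !dotmxZr !ee re0 // add0r.
rewrite (_ : (r k)^* * (i == f k)%:R = 0); last first.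
  by rewrite -[_%:R]conjC_nat -rmorphM eq_sym re0 ?rmorph0.
rewrite addr0.
have [<-|ik] := eqVneq i k.
  rewrite eqxx mulr1 -normCK.
  have : 0 <= D 0 i - 1.
    by case: (D01 i) Di => [->|]; rewrite ?eqxx // subr_ge0.
  by rewrite -sqrtC_ge0 => /ger0_norm ->; rewrite sqrtCK addrC subrK.
rewrite add0r.
have [->|[Di1 _]] := r_gt1 i Di; first by rewrite mul0r.
have [->|[Dk1 _]] := r_gt1 k Dk; first by rewrite rmorph0 mul0r mulr0.
by rewrite (inj_in_eq f_inj) // (negPf ik) !mulr0.
Qed.

(** In the eigenbasis, the number of [D i > 1] is at most [\rank W], hence at most the number of
    [D i = 0]. The diagonal solution is then conjugated back by [S]. *)
Lemma spectral_idempotent A : spectral_conditions A ->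
  exists2 P, P *m P = P & P *m P^t* = A.
Proof.
case=> /psd_hermitian/hermitian_diagonalization[S [D [SS SS' AE]]] specA [W WP rkW].
have D01 i : D 0 i = 0 \/ 1 <= D 0 i by apply/specA/(diag_eigenvalue SS AE).
have rk : (\rank (gt1_basis S D) <= \rank W)%N.
  apply/mxrankS/rV_subP => x xB; apply/WP; exact: (gt1_basisP SS SS' AE x).1 xB.
have [Q QQ QD] := diag_idempotent D01 (leq_trans (rank_gt1_basis_ge D SS)
  (leq_trans (leq_trans rk rkW) (rank_kermx_diag SS SS' AE))).
exists (S^t* *m Q *m S).
  by rewrite !mulmxA -(mulmxA _ S) SS mulmx1 -(mulmxA _ Q Q) QQ.
rewrite !trmx_mul !map_mxM trmxCK !mulmxA -(mulmxA _ S) SS mulmx1.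
by rewrite -(mulmxA _ Q (Q^t*)) QD -AE.
Qed.

Theorem idempotent_iff_spectral A :
  (exists2 P, P *m P = P & P *m P^t* = A) <-> spectral_conditions A.
Proof.
split; last exact: spectral_idempotent.
by case=> P PP <-; apply: idempotent_spectral.
Qed.

End Spectral.

(** * Comparison of the Euclidean norm with entrywise bounds *)

Section EuclideanNorm.
Variables (C : numClosedFieldType) (d : nat).
Implicit Types (x : 'rV[C]_d) (B : 'M[C]_d).

Definition l2norm x : C := sqrtC (dotmx x x).

Lemma l2norm_ge0 x : 0 <= l2norm x.
Proof. by rewrite sqrtC_ge0 dotmx_ge0. Qed.

Lemma dotmx_norm x : dotmx x x = \sum_i `|x 0 i| ^+ 2.
Proof. by rewrite dotmx_sum; apply: eq_bigr => i _; rewrite normCK. Qed.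

Lemma coord_le_l2norm x i : `|x 0 i| <= l2norm x.
Proof.
rewrite -(@ler_pXn2r _ 2) ?nnegrE ?l2norm_ge0 // sqrtCK dotmx_norm.
by rewrite (bigD1 i) //= lerDl sumr_ge0 // => j _; rewrite exprn_ge0.
Qed.

Lemma l2norm_le_sum x : l2norm x <= \sum_i `|x 0 i|.
Proof.
rewrite -(@ler_pXn2r _ 2) ?nnegrE ?l2norm_ge0 ?sumr_ge0 // sqrtCK dotmx_norm.
rewrite expr2 mulr_suml; apply: ler_sum => i _; rewrite expr2 ler_wpM2l //.
by rewrite (bigD1 i) //= lerDl sumr_ge0.
Qed.

(** The norm of the image is at most the sum of its coordinates' moduli, to which each of the
    [d * d] entries contributes at most [e * l2norm x]. *)
Lemma l2norm_mul_le x B e : (forall i j, `|B i j| <= e) ->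
  l2norm (x *m B) <= (d * d)%:R * e * l2norm x.
Proof.
move=> Be; apply: le_trans (l2norm_le_sum _) _.
have -> : (d * d)%:R * e * l2norm x = \sum_(j < d) \sum_(i < d) l2norm x * e.
  by rewrite !sumr_const card_ord -mulrnA -[RHS]mulr_natl -mulrA (mulrC e).
apply: ler_sum => j _; rewrite mxE; apply: le_trans (ler_norm_sum _ _ _) _.
apply: ler_sum => i _; rewrite normrM; apply: ler_pM => //.
exact: coord_le_l2norm.
Qed.

Lemma entry_le_l2norm B e i j :
  (forall x, l2norm (x *m B) <= e * l2norm x) -> `|B i j| <= e.
Proof.
move=> hB; have -> : B i j = ((delta_mx 0 i : 'rV[C]_d) *m B) 0 j by rewrite -rowE mxE.
apply: le_trans (coord_le_l2norm _ _) (le_trans (hB _) _).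
have := dotmx_delta (1%:M : 'M[C]_d) i i; rewrite mulmx1 mxE eqxx => dii.
by rewrite /l2norm dii sqrtC1 mulr1.
Qed.

End EuclideanNorm.

(** * Transfer to matrices over [R[i]] *)

(** This provides the Archimedean structure under which the preceding results apply to [R[i]]. *)
Lemma complex_archimedean (R : archiRcfType) : Num.archimedean_axiom R[i].
Proof.
move=> z; rewrite normc_def; set r := Num.sqrt _.
exists (Num.bound r); rewrite -(rmorph_nat (real_complex R)) ltcR.
exact/archi_boundP/sqrtr_ge0.
Qed.

HB.instance Definition _ (R : archiRcfType) :=
  Num.NumDomain_bounded_isArchimedean.Build R[i] (@complex_archimedean R).

Local Notation R := Rdefinitions.RbaseSymbolsImpl.R.

Definition toK (z : C) : R[i] := Complex (Cre z) (Cim z).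
Definition ofK (z : R[i]) : C := mkC (complex.Re z) (complex.Im z).

Lemma toKK : cancel toK ofK. Proof. by case. Qed.
Lemma ofKK : cancel ofK toK. Proof. by case. Qed.

Lemma toK_add z w : toK (Cadd z w) = toK z + toK w. Proof. by []. Qed.
Lemma toK_mul z w : toK (Cmul z w) = toK z * toK w. Proof. by []. Qed.
Lemma toK_conj z : toK (Cconj z) = (toK z)^*. Proof. by []. Qed.

Lemma toK_sum n f : toK (Csum n f) = \sum_(i < n) toK (f i).
Proof. by elim: n => [|n IHn]; rewrite ?big_ord0 // big_ord_recr /= toK_add IHn. Qed.

Lemma toK_Cmod z : (Cmod z)%:C%C = `|toK z|.
Proof. by rewrite normc_def /Cmod RsqrtE. Qed.

Lemma Cmod_eq1 z : Cmod z = 1 <-> `|toK z| = 1.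
Proof. by rewrite -toK_Cmod; split=> [->|[->]]. Qed.

Section Transfer.
Variable d : nat.
Implicit Types (x y : vec) (A B T : Mat).

(* Operators act on the right of row vectors, hence the transposition in [toM]. *)
Definition toV x : 'rV[R[i]]_d := \row_j toK (x j).
Definition toM A : 'M[R[i]]_d := \matrix_(i, j) toK (A j i).
(** Indices from [d] on are padded with [C0]; [veq] never looks at them. *)
Definition ofV (v : 'rV[R[i]]_d) : vec :=
  fun i => if insub i is Some k then ofK (v 0 k) else C0.
Definition ofM (M : 'M[R[i]]_d) : Mat := fun i j =>
  if insub i is Some k then if insub j is Some l then ofK (M l k) else C0 else C0.

Lemma ofVK : cancel ofV toV.
Proof. by move=> v; apply/rowP => j; rewrite mxE /ofV valK ofKK. Qed.

Lemma ofMK : cancel ofM toM.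
Proof. by move=> M; apply/matrixP => i j; rewrite mxE /ofM !valK ofKK. Qed.

Lemma toV_eq x y : veq d x y <-> toV x = toV y.
Proof.
split=> [h|/rowP h i /ssrnat.ltP id].
  by apply/rowP => j; rewrite !mxE h //; apply/ssrnat.ltP.
by have := h (Ordinal id); rewrite !mxE => /(can_inj toKK).
Qed.

Lemma toM_eq A B : meq d A B <-> toM A = toM B.
Proof.
split=> [h|/matrixP h i j /ssrnat.ltP id /ssrnat.ltP jd].
  by apply/matrixP => i j; rewrite !mxE h //; apply/ssrnat.ltP.
by have := h (Ordinal jd) (Ordinal id); rewrite !mxE => /(can_inj toKK).
Qed.

Lemma toV_zero : toV vzero = 0.
Proof. by apply/rowP => j; rewrite !mxE. Qed.

Lemma toV_scale c x : toV (vscale c x) = toK c *: toV x.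
Proof. by apply/rowP => j; rewrite !mxE toK_mul. Qed.

Lemma toV_sum n f : toV (vsum n f) = \sum_(i < n) toV (f i).
Proof.
apply/rowP => j; rewrite mxE toK_sum summxE.
by apply: eq_bigr => i _; rewrite mxE.
Qed.

Lemma toV_mv A x : toV (mv d A x) = toV x *m toM A.
Proof.
apply/rowP => j; rewrite !mxE toK_sum; apply: eq_bigr => i _.
by rewrite !mxE toK_mul mulrC.
Qed.

Lemma toM_mul A B : toM (mmul d A B) = toM B *m toM A.
Proof.
apply/matrixP => i j; rewrite !mxE toK_sum; apply: eq_bigr => k _.
by rewrite !mxE toK_mul mulrC.
Qed.

Lemma toM_adj A : toM (adj A) = (toM A)^t*.
Proof. by apply/matrixP => i j; rewrite !mxE. Qed.

Lemma toM_Id : toM Id = 1%:M.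
Proof.
apply/matrixP => i j; rewrite !mxE /Id eq_sym -val_eqE /=.
by case: PeanoNat.Nat.eqb_spec => [->|/eqP/negPf ->]; rewrite ?eqxx.
Qed.

Lemma toM_sub A B : toM (msub A B) = toM A - toM B.
Proof. by apply/matrixP => i j; rewrite !mxE. Qed.

Lemma toM_scal c A : toM (mscal c A) = toK c *: toM A.
Proof. by apply/matrixP => i j; rewrite !mxE toK_mul. Qed.

Lemma toM_pow T n : toM (mpow d T n) = toM T ^+ n.
Proof. by elim: n => [|n IHn]; rewrite ?expr0 ?toM_Id // toM_mul IHn exprS. Qed.

Lemma toM_gram T n : toM (TstarnTn d T n) = gram (toM T) n.
Proof. by rewrite toM_mul toM_adj toM_pow. Qed.

Lemma toK_inner x y : toK (inner d x y) = dotmx (toV x) (toV y).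
Proof.
rewrite dotmx_sum toK_sum; apply: eq_bigr => i _.
by rewrite !mxE toK_mul toK_conj.
Qed.

Lemma toK_vnorm x : (vnorm d x)%:C%C = l2norm (toV x).
Proof.
have := dotmx_ge0 (toV x); rewrite /l2norm -toK_inner /vnorm RsqrtE.
case: (inner d x x) => a b; rewrite lecE /= => /andP[/eqP -> a0].
apply/eqP; rewrite -(@eqrXn2 _ 2) ?ler0c ?sqrtr_ge0 ?sqrtC_ge0 //.
  by rewrite sqrtCK -rmorphXn /= sqr_sqrtr.
by rewrite lecE /= eqxx.
Qed.

Lemma opnorm_transfer A e : (forall x, Rdefinitions.Rle (vnorm d (mv d A x)) (e * vnorm d x)) <->
  (forall v, l2norm (v *m toM A) <= e%:C%C * l2norm v).
Proof.
split=> [h v|h x].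
  have /RleP := h (ofV v); rewrite -lecR !toK_vnorm toV_mv ofVK => /le_trans -> //.
  by rewrite rmorphM /= toK_vnorm ofVK.
by apply/RleP; rewrite -lecR rmorphM /= !toK_vnorm toV_mv.
Qed.

Lemma power_boundedP T : power_bounded d T <-> entries_bounded (toM T).
Proof.
split=> [[M hM]|[K hK]].
  exists M%:C%C => n i j; rewrite -toM_pow; apply: entry_le_l2norm.
  by apply/opnorm_transfer/hM.
(* For [d = 0] nothing forces [K] to be real; [|K|] is real in any case and equals [K] as soon as
   there is an entry. *)
exists (complex.Re ((d * d)%:R * `|K|)) => n.
apply/opnorm_transfer => v; rewrite toM_pow RRe_real; last first.
  by rewrite realM ?realn ?normr_real.
apply: l2norm_mul_le => i j; apply: le_trans (hK n i j) _.
by rewrite ger0_norm // (le_trans _ (hK n i j)).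
Qed.

Lemma mat_limitP (S : nat -> Mat) L :
  mat_limit d S L <-> mx_tends (fun n => toM (S n)) (toM L).
Proof.
split=> [h i j e e0|h eps /RltP eps0].
  have ee : e = (complex.Re e)%:C%C by rewrite RRe_real // gtr0_real.
  have [|N hN] := h (complex.Re e).
    by apply/RltP; rewrite -ltcR -ee.
  exists N => n /ssrnat.leP/hN/opnorm_transfer; rewrite -ee toM_sub => hn.
  by have := entry_le_l2norm i j hn; rewrite !mxE.
(* The added 1 keeps the divisor positive when [d = 0]. *)
have c0 : 0 < ((d * d)%:R + 1)%:C%C :> R[i] by rewrite ltcR ltr_wpDl.
pose e := eps%:C%C / ((d * d)%:R + 1)%:C%C.
have e0 : 0 < e by rewrite divr_gt0 // ltcR.
have /fin_all_exists[f hf] : forall p : 'I_d * 'I_d, exists N, forall n,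
    (N <= n)%N -> `|toM (S n) p.1 p.2 - toM L p.1 p.2| <= e.
  by case=> i j; apply: h.
exists (\max_p f p) => n /ssrnat.leP hn; apply/opnorm_transfer => v.
apply: le_trans (@l2norm_mul_le _ _ v _ e _) _ => [i j|].
  rewrite toM_sub !mxE; have := hf (i, j) n; rewrite !mxE; apply.
  by apply: leq_trans hn; apply: (leq_bigmax (i, j)).
rewrite ler_wpM2r ?l2norm_ge0 // mulrCA -[leRHS]mulr1 ler_pM2l ?ltcR //.
rewrite ler_pdivrMr // mul1r -(rmorph_nat (real_complex R)) lecR.
by rewrite lerDl.
Qed.

Lemma in_eigenspaceP T c x :
  in_eigenspace d T c x <-> toV x *m toM T = toK c *: toV x.
Proof. by rewrite -toV_mv -toV_scale; apply: toV_eq. Qed.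

Lemma unimodular_orthogonalP T :
  unimodular_eigenspaces_orthogonal d T <-> unimodular_orthogonal (toM T).
Proof.
split=> [h a b v w a1 b1 ab av bw|h a b x y].
  have := h (ofK a) (ofK b) (ofV v) (ofV w).
  rewrite !Cmod_eq1 !ofKK !in_eigenspaceP !ofVK !ofKK => {}h.
  rewrite -[v]ofVK -[w]ofVK -toK_inner h // => /(can_inj ofKK) /eqP.
  by rewrite (negPf ab).
move=> /Cmod_eq1 a1 /Cmod_eq1 b1 ab /in_eigenspaceP ax /in_eigenspaceP by_.
apply: (can_inj toKK); rewrite toK_inner (h (toK a) (toK b)) //.
by apply/eqP => /(can_inj toKK).
Qed.

Lemma idem_setP A : idem_set d A <->
  exists2 P : 'M[R[i]]_d, P *m P = P & P *m P^t* = toM A.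
Proof.
split=> [[P [/toM_eq PP /toM_eq PA]]|[P PP PA]].
  by exists (toM P); rewrite -?toM_adj -toM_mul.
exists (ofM P); split; apply/toM_eq; first by rewrite toM_mul ofMK.
by rewrite toM_mul toM_adj ofMK.
Qed.

Lemma mat_limit_gramP T L :
  mat_limit d (TstarnTn d T) L <-> mx_tends (gram (toM T)) (toM L).
Proof.
split=> [/mat_limitP h i j|h].
  by apply: eq_tends0 (h i j) => n; rewrite toM_gram.
by apply/mat_limitP => i j; apply: eq_tends0 (h i j) => n; rewrite toM_gram.
Qed.

Lemma limit_setP A : limit_set d A <->
  exists2 T : 'M[R[i]]_d, entries_bounded T & mx_tends (gram T) (toM A).
Proof.
split=> [[T [/power_boundedP bT /mat_limit_gramP TA]]|[T]].
  by exists (toM T).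
rewrite -[T]ofMK => bT TA; exists (ofM T).
by split; [apply/power_boundedP|apply/mat_limit_gramP].
Qed.

Lemma pos_semidefP A : pos_semidef d A <-> psd (toM A).
Proof.
have key x : (Cim (inner d (mv d A x) x) = 0 /\
    Rdefinitions.Rle 0 (Cre (inner d (mv d A x) x))) <->
    0 <= dotmx (toV x *m toM A) (toV x).
  rewrite -toV_mv -toK_inner lecE /=; split=> [[-> /RleP ->]|/andP[/eqP -> /RleP]] //.
  by rewrite eqxx.
split=> [h v|h x]; last exact/key.
by rewrite -[v]ofVK; apply/key/h.
Qed.

Lemma spectrumP A c : spectrum d A c <-> toM A - (toK c)%:M \notin unitmx.
Proof.
have -> : toM A - (toK c)%:M = toM (msub A (mscal c Id)).
  by rewrite toM_sub toM_scal toM_Id scalemx1.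
rewrite /spectrum; set M := msub _ _; split=> [h|/negP h [B [/toM_eq MB _]]].
  apply/negP => U; apply: h; exists (ofM (invmx (toM M))).
  by split; apply/toM_eq; rewrite toM_mul ofMK toM_Id ?mulVmx ?mulmxV.
by apply: h; move: MB; rewrite toM_mul toM_Id => /mulmx1_unit[].
Qed.

Lemma spec_range_gt1P A x : spec_range_gt1 d A x <->
  eigsum (fun a => 1 < a) (toM A) (toV x).
Proof.
split=> [[n [v [l [hv /toV_eq ->]]]]|].
  rewrite toV_sum; apply: big_ind => [|y z|i _]; [exact: eigsum0|exact: eigsumD|].
  have [|/RltP l1 /in_eigenspaceP av] := hv i; first by apply/ssrnat.ltP.
  by apply: (@eigsum1 _ _ (fun a => 1 < a) _ _ _ _ av); rewrite ltcR.
move=> hx; suff [n [v [l [hv xE]]]] : exists n (v : nat -> vec) (l : nat -> R),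
    (forall i, (i < n)%coq_nat -> Rdefinitions.Rlt 1 (l i) /\ in_eigenspace d A (RtoC (l i)) (v i)) /\
    toV x = \sum_(i < n) toV (v i).
  by exists n, v, l; split=> //; apply/toV_eq; rewrite toV_sum.
elim: hx => [|a w y a1 aw _ [n [v [l [hv ->]]]]].
  by exists 0%N, (fun=> vzero), (fun=> 0); rewrite big_ord0; split=> // i /ssrnat.ltP.
(* The new eigenvector goes in at index [n]; its eigenvalue is real because it exceeds 1. *)
exists n.+1, (fun i => if (i < n)%N then v i else ofV w),
  (fun i => if (i < n)%N then l i else complex.Re a); split=> [i _|].
  case: ssrnat.ltP => [/hv//|_]; split.
    by move: a1; rewrite ltcE => /andP[_ /RltP].
  apply/in_eigenspaceP; rewrite ofVK aw; congr (_ *: _).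
  by rewrite -[LHS]RRe_real // gtr0_real // (lt_trans ltr01).
rewrite big_ord_recr /= ltnn ofVK addrC; congr (_ + _).
by apply: eq_bigr => i _; rewrite ltn_ord.
Qed.

Lemma lin_indepP k (v : nat -> vec) :
  lin_indep d k v <-> row_free (\matrix_(i < k) toV (v i)).
Proof.
have sumE c : toV (vsum k (fun i => vscale (c i) (v i))) =
    (\row_(i < k) toK (c i)) *m (\matrix_(i < k) toV (v i)).
  rewrite toV_sum mulmx_sum_row; apply: eq_bigr => i _.
  by rewrite toV_scale rowK mxE.
split=> [h|h c /toV_eq].
  rewrite -kermx_eq0; apply/rowV0P => r /sub_kermxP rv.
  pose c i := if insub i is Some j then ofK (r 0 j) else C0.
  have rc : \row_(i < k) toK (c i) = r.
    by apply/rowP => i; rewrite mxE /c valK ofKK.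
  apply/rowP => i; rewrite -rc !mxE (h c) //; last exact/ssrnat.ltP.
  by apply/toV_eq; rewrite sumE rc rv toV_zero.
rewrite sumE toV_zero => /eqP; rewrite mulmx_free_eq0 // => /eqP/rowP c0 i /ssrnat.ltP ik.
by apply: (can_inj toKK); have := c0 (Ordinal ik); rewrite !mxE.
Qed.

Lemma lin_indep_in_rank (V : vec -> Prop) (W : 'M[R[i]]_d) n :
  (forall x, V x <-> (toV x <= W)%MS) ->
  (exists v, (forall i, (i < n)%coq_nat -> V (v i)) /\ lin_indep d n v) <->
  (n <= \rank W)%N.
Proof.
move=> VW; split=> [[v [vV /lin_indepP fv]]|nW].
  rewrite -(eqP fv); apply/mxrankS/row_subP => i; rewrite rowK.
  by apply/VW/vV/ssrnat.ltP.
(* The first [n] rows of a basis of the row space of [W]. *)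
pose B : 'M_(n, d) := pid_mx n *m row_base W.
pose v i := if insub i is Some k then ofV (row (k : 'I_n) B) else vzero.
have Bv : \matrix_(i < n) toV (v i) = B.
  by apply/row_matrixP => i; rewrite rowK /v valK ofVK.
exists v; split=> [i /ssrnat.ltP ik|].
  apply/VW; rewrite /v insubT ofVK; apply: submx_trans (row_sub _ _) _.
  by rewrite mulmx_sub // eq_row_base.
by apply/lin_indepP; rewrite Bv /row_free mxrankMfree ?row_base_free // rank_pid_mx.
Qed.

Lemma is_dimP (V : vec -> Prop) (W : 'M[R[i]]_d) n :
  (forall x, V x <-> (toV x <= W)%MS) -> is_dim d V n <-> n = \rank W.
Proof.
move=> VW; rewrite /is_dim !(lin_indep_in_rank _ VW); split=> [[nW /negP]|->].
  by rewrite -leqNgt => Wn; apply/eqP; rewrite eqn_leq nW.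
by split=> //; rewrite ltnn.
Qed.

Lemma kernelP A x : kernel d A x <-> (toV x <= kermx (toM A))%MS.
Proof.
rewrite /kernel toV_eq toV_mv toV_zero.
by split=> [h|/sub_kermxP]; first exact/sub_kermxP.
Qed.

Lemma spectral_setP A : spectral_set d A <-> spectral_conditions (toM A).
Proof.
have eigP c : (c = C0 \/ (Cim c = 0 /\ Rdefinitions.Rle 1 (Cre c))) <->
    (toK c = 0 \/ 1 <= toK c).
  rewrite lecE /=; split=> [[->|[-> /RleP ->]]|[h|/andP[/eqP c0 /RleP c1]]].
  - by left.
  - by right; rewrite eqxx.
  - by left; apply: (can_inj toKK).
  - by right.
split=> [[/pos_semidefP Apos [specA [m [r [dm [dr rm]]]]]]|[Apos specA [W WP rk]]].
  split=> // [a|].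
    by rewrite -[a]ofKK => /spectrumP/specA/eigP.
  (* Diagonalization presents the spectral subspace as a row space, so that its dimension [r]
     becomes a rank. *)
  have [W WP] := psd_gt1_space Apos; exists W => //.
  have rW x : spec_range_gt1 d A x <-> (toV x <= W)%MS.
    by rewrite WP; apply: spec_range_gt1P.
  rewrite -((is_dimP _ rW).1 dr) -((is_dimP _ (kernelP A)).1 dm).
  exact/ssrnat.leP.
split; first exact/pos_semidefP.
split=> [c /spectrumP/specA/eigP//|].
exists (\rank (kermx (toM A))), (\rank W); split; last split.
- exact/(is_dimP _ (kernelP A)).
- by apply/(@is_dimP _ W) => // x; rewrite WP; apply: spec_range_gt1P.
- exact/ssrnat.leP.
Qed.

End Transfer.

Theorem mainTheorem10 (d : nat) :
  (forall T : Mat, power_bounded d T ->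
     (mat_converges d (TstarnTn d T) <-> unimodular_eigenspaces_orthogonal d T)) /\
  (forall A : Mat,
     (limit_set d A <-> idem_set d A) /\ (idem_set d A <-> spectral_set d A)).
Proof.
split=> [T /power_boundedP bT|A].
  rewrite unimodular_orthogonalP -(gram_converges_iff bT).
  split=> [[L /mat_limit_gramP TL]|[L]]; first by exists (toM d L).
  by rewrite -[L]ofMK => TL; exists (ofM L); apply/mat_limit_gramP.
rewrite limit_setP idem_setP spectral_setP.
split; [exact: gram_limit_idempotent|exact: idempotent_iff_spectral].
Qed.
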